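(* Let $A=(P,V,\mathit{inp},\mathit{out})$ be an architecture, let $p\in P$ be a single process, and let $\varphi=\varphi_1\wedge\dots\wedge\varphi_n$ be a prioritized LTL specification over $V$. Then one can construct a parity tree automaton (over the unary binary encoding of assumption trees described in the context) such that the trees accepted by the automaton are exactly the dominant strategy annotated assumption trees of $p$.
   Context: An architecture is a tuple $A=(P,V,\mathit{inp},\mathit{out})$ where $P$ is a finite set of processes, $V$ a finite set of Boolean variables, and $\mathit{inp},\mathit{out}:P\to 2^V$ assign to each process disjoint sets of input and output variables, with outputs of distinct processes disjoint; variables that are outputs of no process are external inputs and are inputs of every process. A prioritized specification is a conjunction $\varphi=\varphi_1\wedge\dots\wedge\varphi_n$ of LTL formulas over $V$, $\varphi_1$ the most important; a computation (infinite sequence of valuations of $V$) $\sigma$ satisfies $\varphi$ up to priority $k$ if $\sigma\models\bigwedge_{i\le k}\varphi_i$. An assumption tree for process $p$ is a subtree (prefix-closed set of nodes) of the full tree with directions $\mathbb N\cup 2^{V\setminus\mathit{out}(p)}$ in which, on every path, directions alternate between a natural number and an element of $2^{V\setminus\mathit{out}(p)}$ (starting with a natural number). Intuitively a number is a promise by the environment restricting its future behaviour and the subsequent valuations are the execution of the promise. A strategy annotation of an assumption tree labels every node reached by a natural-number edge with an output value in $2^{\mathit{out}(p)}$. Along any infinite path of the tree (an alternating sequence of natural numbers and valuations of $V\setminus\mathit{out}(p)$), the annotation yields a computation by combining, at each step, the annotated output at the node reached by the number with the environment valuation on the following edge. A strategy annotation $t$ is dominated by a strategy annotation $s$ of the same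 tree, $t\preceq s$, iff for every such path present in the tree, if the computation resulting from $t$ satisfies $\varphi$ up to priority $m$, then the computation resulting from $s$ satisfies $\varphi$ up to some priority $n'\ge m$. An annotation $s$ is dominant if $t\preceq s$ for all annotations $t$; a dominant strategy annotated assumption tree is an assumption tree together with a dominant strategy annotation. Since assumption trees have infinite branching, they are represented for tree automata via the unary encoding of $\mathbb N^*$ in $\mathbb B^*$, where $abc\ldots\in\mathbb N^*$ is encoded as $0^a10^b10^c1\ldots$ (and partial trees are embedded into full trees by a Boolean label marking present nodes). A parity tree automaton is an alternating tree automaton with a coloring of states by natural numbers, accepting a run tree when on every path the highest color occurring infinitely often is even. *)

(* Defs.v *)
From HB Require Import structures.
From mathcomp Require Import all_boot.

Set Implicit Arguments.
Unset Strict Implicit.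
Unset Printing Implicit Defensive.

Record architecture := Architecture {
  proc : finType;
  var : finType;
  inp : proc -> {set var};
  out : proc -> {set var};
  inp_out_disjoint : forall p, [disjoint inp p & out p];
  out_disjoint : forall p q, p != q -> [disjoint out p & out q];
  external_inp : forall v, (forall q, v \notin out q) -> forall p, v \in inp p
}.

(* An element of 2^W is the set of variables of W that are true. *)
Definition valuation (V : finType) (W : {set V}) : finType :=
  {S : {set V} | S \subset W}.

Inductive ltl (V : Type) :=
| LTrue
| LVar of V
| LNot of ltl V
| LOr of ltl V & ltl V
| LNext of ltl V
| LUntil of ltl V & ltl V.

Definition computation (V : finType) := nat -> {set V}.

Fixpoint ltl_sat_at (V : finType) (sigma : computation V) (f : ltl V) (i : nat)
    : Prop :=
  match f with
  | LTrue => True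
  | LVar v => v \in sigma i
  | LNot g => ~ ltl_sat_at sigma g i
  | LOr g h => ltl_sat_at sigma g i \/ ltl_sat_at sigma h i
  | LNext g => ltl_sat_at sigma g i.+1
  | LUntil g h =>
      exists j, [/\ i <= j, ltl_sat_at sigma h j &
                    forall k, i <= k < j -> ltl_sat_at sigma g k]
  end.

Definition ltl_sat (V : finType) (sigma : computation V) (f : ltl V) : Prop :=
  ltl_sat_at sigma f 0.

(* The conjunct of priority i + 1 is tnth phi i. *)
Definition sat_upto (V : finType) (n : nat) (phi : n.-tuple (ltl V))
    (sigma : computation V) (k : nat) : Prop :=
  forall i : 'I_n, i < k -> ltl_sat sigma (tnth phi i).

Definition envval (A : architecture) (p : proc A) : finType :=
  valuation (~: out p).

Definition outval (A : architecture) (p : proc A) : finType :=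
  valuation (out p).

Definition adir (A : architecture) (p : proc A) : Type := (nat + envval p)%type.

Definition anode (A : architecture) (p : proc A) : Type := seq (adir p).

(* num tells whether the next direction must be a number. *)
Fixpoint alternating (A : architecture) (p : proc A) (num : bool)
    (v : anode p) : bool :=
  match v with
  | [::] => true
  | inl _ :: v' => num && alternating false v'
  | inr _ :: v' => ~~ num && alternating true v'
  end.

Definition assumption_tree (A : architecture) (p : proc A)
    (T : pred (anode p)) : Prop :=
  (forall u v, T (u ++ v) -> T u) /\ (forall v, T v -> alternating true v).

Definition number_node (A : architecture) (p : proc A) (v : anode p) : bool :=
  if v is d :: v' then (if last d v' is inl _ then true else false) else false.

(* An annotation of T is a function on all nodes of which only the values at
   the number nodes of T are ever used (in computations and in encodings). *)
Definition annotation (A : architecture) (p : proc A) : Type :=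
  anode p -> outval p.

(* The infinite path a_0 e_0 a_1 e_1 ... is given as i |-> (a_i, e_i). *)
Definition apath (A : architecture) (p : proc A) : Type :=
  nat -> nat * envval p.

Definition path_even (A : architecture) (p : proc A) (pi : apath p) (i : nat)
    : anode p :=
  flatten (mkseq (fun j => [:: inl (pi j).1; inr (pi j).2]) i).

Definition path_odd (A : architecture) (p : proc A) (pi : apath p) (i : nat)
    : anode p :=
  rcons (path_even pi i) (inl (pi i).1).

Definition path_in (A : architecture) (p : proc A) (T : pred (anode p))
    (pi : apath p) : Prop :=
  forall i, T (path_even pi i) /\ T (path_odd pi i).

Definition path_computation (A : architecture) (p : proc A) (s : annotation p)
    (pi : apath p) : computation (var A) :=
  fun i => val (s (path_odd pi i)) :|: val (pi i).2.

Definition dominated (A : architecture) (p : proc A) (n : nat)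
    (phi : n.-tuple (ltl (var A))) (T : pred (anode p)) (t s : annotation p)
    : Prop :=
  forall pi, path_in T pi ->
  forall m, 0 < m <= n -> sat_upto phi (path_computation t pi) m ->
  exists n', m <= n' <= n /\ sat_upto phi (path_computation s pi) n'.

Definition dominant (A : architecture) (p : proc A) (n : nat)
    (phi : n.-tuple (ltl (var A))) (T : pred (anode p)) (s : annotation p)
    : Prop :=
  forall t, dominated phi T t s.

(* Numbers are encoded in unary over the bits; valuations of the environment,
   which are finitely many, remain single directions. *)
Definition bdir (A : architecture) (p : proc A) : finType :=
  (bool + envval p)%type.

Definition code_dir (A : architecture) (p : proc A) (d : adir p)
    : seq (bdir p) :=
  match d with
  | inl a => rcons (nseq a (inl false)) (inl true)
  | inr e => [:: inr e]
  end.

Definition code (A : architecture) (p : proc A) (v : anode p) : seq (bdir p) :=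
  flatten (map (@code_dir A p) v).

(* The Boolean marks the present nodes; the second component carries the
   output exactly at the annotated nodes. *)
Definition label (A : architecture) (p : proc A) : finType :=
  (bool * option (outval p))%type.

Definition encodes (A : architecture) (p : proc A) (T : pred (anode p))
    (s : annotation p) (t : seq (bdir p) -> label p) : Prop :=
  (forall v, t (code v) =
     (T v, if T v && number_node v then Some (s v) else None)) /\
  (forall w, (forall v, w <> code v) -> t w = (false, None)).

Inductive posbool (X : Type) :=
| PTrue
| PFalse
| PAtom of X
| PAnd of posbool X & posbool X
| POr of posbool X & posbool X.

Fixpoint posbool_sat (X : Type) (S : X -> Prop) (f : posbool X) : Prop :=
  match f with
  | PTrue => True
  | PFalse => False
  | PAtom x => S x
  | PAnd g h => posbool_sat S g /\ posbool_sat S h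
  | POr g h => posbool_sat S g \/ posbool_sat S h
  end.

Record parity_automaton (D L : finType) := ParityAutomaton {
  state : finType;
  init : state;
  delta : state -> L -> posbool (D * state);
  color : state -> nat
}.

(* A run tree is a nonempty prefix-closed R over nat^*, a node y of which is
   labelled with a state and with the node of the input tree it is reading. *)
Definition run_tree (D L : finType) (M : parity_automaton D L)
    (t : seq D -> L) (R : seq nat -> Prop)
    (r : seq nat -> state M * seq D) : Prop :=
  [/\ R [::],
      forall y c, R (rcons y c) -> R y,
      r [::] = (init M, [::]) &
      forall y, R y ->
        (forall c, R (rcons y c) ->
           exists d q, r (rcons y c) = (q, rcons (r y).2 d)) /\
        posbool_sat
          (fun dq => exists c,
             R (rcons y c) /\ r (rcons y c) = (dq.2, rcons (r y).2 dq.1))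
          (delta (r y).1 (t (r y).2))].

(* c is the highest color occurring infinitely often. *)
Definition parity_condition (col : nat -> nat) : Prop :=
  exists c, [/\ ~~ odd c,
                forall N, exists i, N <= i /\ col i = c &
                exists N, forall i, N <= i -> col i <= c].

Definition accepts (D L : finType) (M : parity_automaton D L)
    (t : seq D -> L) : Prop :=
  exists R r, @run_tree D L M t R r /\
    forall b : nat -> nat, (forall i, R (mkseq b i)) ->
      parity_condition (fun i => color (r (mkseq b i)).1).

(* Main.v *)
Require Import Defs.
From HB Require Import structures.
From mathcomp Require Import all_boot boolp.

Set Implicit Arguments.
Unset Strict Implicit.
Unset Printing Implicit Defensive.

(* Call level of a computation the length of the longest prefix of the priority
   list that it satisfies. A path visits nodes of distinct sizes, so along a
   fixed path the outputs of a rival annotation are arbitrary, and s is dominant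
   iff no path admits outputs of a higher level than those of s. The words
   (outputs of s, valuations) that admit better outputs form the language of a
   nondeterministic Büchi automaton: guess the outputs, and evaluate the
   formulas compositionally by nondeterministic fair transducers. Dually, a
   universal co-Büchi automaton, which needs no determinization to be run on all
   branches of a tree, rejects the trees having such a path. It also checks that
   the tree is an encoding. *)

Definition infinitely_often (P : nat -> Prop) : Prop :=
  forall N, exists2 i, N <= i & P i.

Lemma not_infinitely_often (P : nat -> Prop) :
  ~ infinitely_often P <-> exists N, forall i, N <= i -> ~ P i.
Proof.
split=> [fin|[N nP] inf]; last by have [i /nP] := inf N.
apply: contrapT => all_late; apply: fin => N; apply: contrapT => none_late.
by apply: all_late; exists N => i Ni Pi; apply: none_late; exists i.
Qed.

Lemma parity_condition_bool (b : nat -> bool) :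
  parity_condition (fun i => b i : nat) <-> ~ infinitely_often b.
Proof.
split=> [[c [c_even c_inf [N c_max]]] b_inf|/not_infinitely_often[N late]].
  have [i Ni bi] := b_inf N; have := c_max i Ni; rewrite bi.
  have [j [_ bj]] := c_inf 0; rewrite -bj in c_even *.
  by case: (b j) c_even.
have b0 i : N <= i -> b i = false by move=> /late/negP/negPf.
exists 0; split=> // [M|]; last by exists N => i /b0 ->.
by exists (maxn M N); rewrite leq_maxl b0 // leq_maxr.
Qed.

(** * Universal tree automata *)

Section PosboolAll.
Variables (X : eqType) (S : X -> Prop).

Definition posbool_all (s : seq X) : posbool X :=
  foldr (fun x => PAnd (PAtom x)) (PTrue X) s.

Lemma posbool_sat_all (s : seq X) :
  posbool_sat S (posbool_all s) <-> {in s, forall x, S x}.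
Proof.
elim: s => [|x s IHs] //=; rewrite IHs; split=> [[Sx Ss] y|Ss].
  by rewrite inE => /predU1P[->|/Ss].
by split=> [|y ys]; apply: Ss; rewrite inE ?eqxx ?ys ?orbT.
Qed.

End PosboolAll.

Section Universal.
Variables (D L Q : finType) (q0 : Q) (ok : Q -> L -> bool).
Variables (next : Q -> L -> D -> Q -> bool) (col : Q -> nat).

Definition universal_delta (q : Q) (l : L) : posbool (D * Q) :=
  if ok q l then posbool_all (enum [pred dq : D * Q | next q l dq.1 dq.2])
  else PFalse _.

Definition universal_automaton : parity_automaton D L :=
  ParityAutomaton q0 universal_delta col.

Lemma universal_deltaP (S : D * Q -> Prop) q l :
  posbool_sat S (universal_delta q l) <->
  ok q l /\ forall d q', next q l d q' -> S (d, q').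
Proof.
rewrite /universal_delta; case: (ok q l); last by split=> // -[].
rewrite posbool_sat_all; split=> [Sn|[_ Sn] [d q']].
  by split=> // d q' nq; apply: Sn; rewrite mem_enum.
by rewrite mem_enum => /Sn.
Qed.

Variable t : seq D -> L.

Inductive reachable : seq D -> Q -> Prop :=
| reachable_init : reachable [::] q0
| reachable_rcons w q d q' :
    reachable w q -> next q (t w) d q' -> reachable (rcons w d) q'.

Definition infinite_trace (w : nat -> D) (q : nat -> Q) : Prop :=
  q 0 = q0 /\ forall i, next (q i) (t (mkseq w i)) (w i) (q i.+1).

Lemma accepts_reachable_ok w q :
  accepts universal_automaton t -> reachable w q -> ok q (t w).
Proof.
move=> [R [r [[R0 _ r0 Rr] _]]] wq.
have [y Ry ry] : exists2 y, R y & r y = (q, w).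
  elim: wq => [|{}w {}q d q' _ [y Ry ry] nq]; first by exists [::].
  have [_] := Rr _ Ry; rewrite ry.
  move=> /universal_deltaP[_ /(_ _ _ nq)[c [Rc rc]]].
  by exists (rcons y c).
by have [_] := Rr _ Ry; rewrite ry => /universal_deltaP[].
Qed.

Lemma accepts_trace_parity w q :
  accepts universal_automaton t -> infinite_trace w q ->
  parity_condition (fun i => col (q i)).
Proof.
move=> [R [r [[R0 _ r0 Rr] Rpar]]] [q_0 qS].
have /choice[child childP] : forall iy : nat * seq nat, exists c : nat,
    R iy.2 -> r iy.2 = (q iy.1, mkseq w iy.1) ->
    R (rcons iy.2 c) /\ r (rcons iy.2 c) = (q iy.1.+1, mkseq w iy.1.+1).
  move=> [i y] /=; have [[Ry ry]|nRy] := pselect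
    (R y /\ r y = (q i, mkseq w i)); last by exists 0 => Ry ry; case: nRy.
  have [_] := Rr _ Ry; rewrite ry.
  move=> /universal_deltaP[_ /(_ _ _ (qS i))[c [Rc rc]]].
  by exists c => _ _; rewrite rc mkseqS.
pose y := fix y i := if i is j.+1 then rcons (y j) (child (j, y j)) else [::].
have yP i : R (y i) /\ r (y i) = (q i, mkseq w i).
  by elim: i => [|i [Ry ry]]; [rewrite q_0 | exact: (childP (i, y i))].
have yE i : mkseq (fun j => child (j, y j)) i = y i.
  by elim: i => //= i IHi; rewrite mkseqS IHi.
have /Rpar : forall i, R (mkseq (fun j => child (j, y j)) i).
  by move=> i; rewrite yE; have [] := yP i.
congr parity_condition; apply/funext => i.
by rewrite yE (yP i).2.
Qed.

Definition configuration : Type := (Q * seq D)%type.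

Definition configuration_step (c c' : configuration) : bool :=
  [exists d, (c'.2 == rcons c.2 d) && next c.1 (t c.2) d c'.1].

Lemma path_reachable cs : path configuration_step (q0, [::]) cs ->
  reachable (last (q0, [::]) cs).2 (last (q0, [::]) cs).1.
Proof.
elim/last_ind: cs => [|cs c IHcs]; first by move=> _; exact: reachable_init.
rewrite rcons_path last_rcons => /andP[/IHcs cs_reach].
by move=> /existsP[d /andP[/eqP -> ?]]; apply: reachable_rcons cs_reach _.
Qed.

Lemma configurations_trace (c : nat -> configuration) :
  c 0 = (q0, [::]) -> (forall i, configuration_step (c i) (c i.+1)) ->
  exists w, infinite_trace w (fun i => (c i).1).
Proof.
move=> c_0 cS.
have /choice[w wP] : forall i, exists d,
    (c i.+1).2 = rcons (c i).2 d /\ next (c i).1 (t (c i).2) d (c i.+1).1.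
  by move=> i; have /existsP[d /andP[/eqP ? ?]] := cS i; exists d.
have wE i : mkseq w i = (c i).2.
  elim: i => [|i IHi]; first by rewrite c_0.
  by rewrite mkseqS IHi (wP i).1.
by exists w; split=> [|i]; [rewrite c_0 | rewrite wE; have [] := wP i].
Qed.

(* A node of the run tree lists the codes of the configurations on the way. *)
Definition run_node (y : seq nat) : Prop :=
  exists2 cs : seq configuration,
    path configuration_step (q0, [::]) cs & y = map pickle cs.

Definition run_label (y : seq nat) : configuration :=
  last (q0, [::]) (pmap unpickle y).

Lemma run_label_pickle cs : run_label (map pickle cs) = last (q0, [::]) cs.
Proof. by congr last; apply: map_pK; exact: pickleK. Qed.

Lemma run_node_rcons y b : run_node (rcons y b) -> exists cs c,
  [/\ y = map pickle cs, b = pickle c &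
      path configuration_step (q0, [::]) (rcons cs c)].
Proof.
move=> [cs]; case/lastP: cs => [_|cs c cs_path]; first by case: y.
by rewrite map_rcons => /rcons_inj[-> ->]; exists cs, c.
Qed.

Lemma universal_run_tree :
  (forall w q, reachable w q -> ok q (t w)) ->
  @run_tree D L universal_automaton t run_node run_label.
Proof.
move=> ok_reach; split=> //.
- by exists [::].
- move=> y b /run_node_rcons[cs [c [-> _]]].
  by rewrite rcons_path => /andP[? _]; exists cs.
move=> y y_node; split=> [b /run_node_rcons[cs [c [-> -> cs_path]]]|].
  rewrite -map_rcons !run_label_pickle last_rcons.
  move: cs_path; rewrite rcons_path => /andP[_ /existsP[d /andP[/eqP cE _]]].
  by exists d, c.1; rewrite -cE -surjective_pairing.
case: y_node => cs cs_path ->; rewrite run_label_pickle; apply/universal_deltaP.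
split=> [|d q' nq]; first exact/ok_reach/path_reachable.
set w := (last _ cs).2; exists (pickle (q', rcons w d)).
rewrite -map_rcons run_label_pickle last_rcons; split=> //.
exists (rcons cs (q', rcons w d)) => //; rewrite rcons_path cs_path.
by apply/existsP; exists d; rewrite eqxx.
Qed.

Lemma universal_run_parity b :
  (forall w q, infinite_trace w q -> parity_condition (fun i => col (q i))) ->
  (forall i, run_node (mkseq b i)) ->
  parity_condition (fun i => col (run_label (mkseq b i)).1).
Proof.
move=> trace_par b_nodes.
have /choice[c cP] : forall i, exists c : configuration, b i = pickle c.
  move=> i; have := b_nodes i.+1; rewrite mkseqS.
  by move=> /run_node_rcons[cs [c [_ -> _]]]; exists c.
have bE i : mkseq b i = map pickle (mkseq c i).
  by rewrite -map_comp; apply: eq_map => j /=.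
have c_path i : path configuration_step (q0, [::]) (mkseq c i).
  have [cs cs_path] := b_nodes i; rewrite bE => /inj_map-> //.
  exact: pcan_inj (@pickleK _).
pose d i := run_label (mkseq b i).
have [|i|w /trace_par] := @configurations_trace d; rewrite /d.
- by rewrite bE run_label_pickle.
- rewrite !bE !run_label_pickle; have := c_path i.+1.
  by rewrite mkseqS rcons_path last_rcons => /andP[].
exact.
Qed.

Lemma accepts_universal :
  accepts universal_automaton t <->
  (forall w q, reachable w q -> ok q (t w)) /\
  (forall w q, infinite_trace w q -> parity_condition (fun i => col (q i))).
Proof.
split=> [acc|[ok_reach trace_par]].
  by split=> w q; [exact: accepts_reachable_ok | exact: accepts_trace_parity].
exists run_node, run_label; split; first exact: universal_run_tree.
by move=> b; exact: universal_run_parity.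
Qed.

End Universal.

(** * Fair transducers *)

(* A transducer denotes a relation between infinite words, realized by the
   runs that meet every fairness condition infinitely often. *)
Record transducer (L O : Type) := Transducer {
  tr_state : finType;
  tr_step : tr_state -> L -> tr_state -> bool;
  tr_out : tr_state -> L -> O;
  tr_fairness : finType;
  tr_fair : tr_fairness -> tr_state -> L -> bool
}.

Definition fair_run (L O : Type) (X : transducer L O) (w : nat -> L)
    (x : nat -> tr_state X) : Prop :=
  (forall i, tr_step (x i) (w i) (x i.+1)) /\
  (forall f : tr_fairness X, infinitely_often (fun i => tr_fair f (x i) (w i))).

Definition transduces (L O : Type) (X : transducer L O) (w : nat -> L)
    (v : nat -> O) : Prop :=
  exists2 x, fair_run w x & forall i, tr_out (x i : tr_state X) (w i) = v i.

Definition computes (L O : Type) (X : transducer L O)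
    (F : (nat -> L) -> nat -> O) : Prop :=
  forall w v, transduces X w v <-> v = F w.

Section Combinators.
Variables L M O : Type.

Definition safety_transducer (S : finType) (step : S -> L -> S -> bool)
    (out : S -> L -> O) : transducer L O :=
  Transducer step out (tr_fairness := void) (fun _ _ _ => true).

Lemma transduces_safety (S : finType) (step : S -> L -> S -> bool)
    (out : S -> L -> O) w v :
  transduces (safety_transducer step out) w v <->
  exists x, forall i, step (x i) (w i) (x i.+1) /\ out (x i) (w i) = v i.
Proof.
split=> [[x [xS _] xv]|[x xP]]; first by exists x => i; split; [exact: xS|].
by exists x => [|i]; [split=> [i|[]] | ]; have [] := xP i.
Qed.

Definition letterwise (h : L -> O) : transducer L O :=
  safety_transducer (fun _ _ (_ : unit) => true) (fun _ => h).

Lemma computes_letterwise (h : L -> O) : computes (letterwise h) (comp h).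
Proof.
move=> w v; rewrite transduces_safety; split=> [[x xP]|->].
  by apply/funext => i; have [] := xP i.
by exists (fun=> tt).
Qed.

Definition tr_comp (X : transducer L M) (Y : transducer M O) : transducer L O :=
  Transducer (tr_state := (tr_state X * tr_state Y)%type)
    (tr_fairness := (tr_fairness X + tr_fairness Y)%type)
    (fun xy l xy' =>
       tr_step xy.1 l xy'.1 && tr_step xy.2 (tr_out xy.1 l) xy'.2)
    (fun xy l => tr_out xy.2 (tr_out xy.1 l))
    (fun f xy l => match f with
                   | inl g => tr_fair g xy.1 l
                   | inr g => tr_fair g xy.2 (tr_out xy.1 l)
                   end).

Lemma transduces_comp (X : transducer L M) (Y : transducer M O) w v :
  transduces (tr_comp X Y) w v <->
  exists2 u, transduces X w u & transduces Y u v.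
Proof.
split=> [[xy [xyS xy_fair] xyv]|[u [x [xS x_fair] xu] [y [yS y_fair] yv]]].
  exists (fun i => tr_out (xy i).1 (w i)).
    exists (fun i => (xy i).1) => //.
    by split=> [i|f]; [have /andP[] := xyS i | exact: (xy_fair (inl f))].
  exists (fun i => (xy i).2) => [|i]; last exact: xyv.
  by split=> [i|f]; [have /andP[] := xyS i | exact: (xy_fair (inr f))].
have {}xu : u = (fun i => tr_out (x i) (w i)) by apply/funext.
subst u; exists (fun i => (x i, y i)) => //.
by split=> [i|[f|f]] /=; rewrite ?xS ?yS.
Qed.

Lemma computes_comp (X : transducer L M) (Y : transducer M O) F G :
  computes X F -> computes Y G -> computes (tr_comp X Y) (G \o F).
Proof.
move=> XF YG w v; rewrite transduces_comp; split=> [[u /XF -> /YG]|->] //.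
by exists (F w); [exact/XF | exact/YG].
Qed.

Definition tr_pair (X : transducer L M) (Y : transducer L O)
    : transducer L (M * O) :=
  Transducer (tr_state := (tr_state X * tr_state Y)%type)
    (tr_fairness := (tr_fairness X + tr_fairness Y)%type)
    (fun xy l xy' => tr_step xy.1 l xy'.1 && tr_step xy.2 l xy'.2)
    (fun xy l => (tr_out xy.1 l, tr_out xy.2 l))
    (fun f xy l => match f with
                   | inl g => tr_fair g xy.1 l
                   | inr g => tr_fair g xy.2 l
                   end).

Lemma transduces_pair (X : transducer L M) (Y : transducer L O) w v :
  transduces (tr_pair X Y) w v <->
  transduces X w (fst \o v) /\ transduces Y w (snd \o v).
Proof.
split=> [[xy [xyS xy_fair] xyv]|[[x [xS x_fair] xv] [y [yS y_fair] yv]]].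
  split.
    exists (fun i => (xy i).1) => [|i]; last by rewrite /= -xyv.
    by split=> [i|f]; [have /andP[] := xyS i | exact: (xy_fair (inl f))].
  exists (fun i => (xy i).2) => [|i]; last by rewrite /= -xyv.
  by split=> [i|f]; [have /andP[] := xyS i | exact: (xy_fair (inr f))].
exists (fun i => (x i, y i)) => [|i].
  by split=> [i|[f|f]] /=; rewrite ?xS ?yS.
by rewrite /= xv yv -surjective_pairing.
Qed.

Lemma computes_pair (X : transducer L M) (Y : transducer L O) F G :
  computes X F -> computes Y G ->
  computes (tr_pair X Y) (fun w i => (F w i, G w i)).
Proof.
move=> XF YG w v; rewrite transduces_pair XF YG.
split=> [[vF vG]|->] //; apply/funext => i.
by rewrite -vF -vG -surjective_pairing.
Qed.

End Combinators.

Lemma eq_computes (L O : Type) (X : transducer L O) F G :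
  (forall w i, F w i = G w i) -> computes X F -> computes X G.
Proof. by move=> FG XF w v; rewrite XF (_ : F w = G w) //; apply/funext. Qed.

Definition tr_guess (L : Type) (O : finType) : transducer L (O * L) :=
  safety_transducer (fun _ _ (_ : O) => true) (fun o l => (o, l)).

Lemma transduces_guess (L : Type) (O : finType) (w : nat -> L) v :
  transduces (tr_guess L O) w v <-> exists o, v = (fun i => (o i, w i)).
Proof.
rewrite transduces_safety; split=> -[o oP]; exists o; last by rewrite oP.
by apply/funext => i; have [] := oP i.
Qed.

(* The state holds the current letter and predicts the next one. *)
Definition tr_shift (L : finType) : transducer L L :=
  safety_transducer (fun (x : L * L) l y => (x.1 == l) && (y.1 == x.2))
    (fun x _ => x.2).

Lemma computes_shift (L : finType) :
  computes (tr_shift L) (fun w i => w i.+1).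
Proof.
move=> w v; rewrite transduces_safety; split=> [[x xP]|->].
  apply/funext => i; have [_ <-] := xP i; have [/andP[/eqP <- _] _] := xP i.+1.
  by have [/andP[_ /eqP ->] _] := xP i.
by exists (fun i => (w i, w i.+1)) => i; rewrite !eqxx.
Qed.

Definition word_until (w : nat -> bool * bool) (i : nat) : Prop :=
  exists j, [/\ i <= j, (w j).2 & forall k, i <= k < j -> (w k).1].

Lemma word_until_rec w i :
  word_until w i <-> (w i).2 \/ (w i).1 /\ word_until w i.+1.
Proof.
split=> [[j [ij wj wk]]|[wi|[wi [j [ij wj wk]]]]].
- move: ij; rewrite leq_eqVlt => /predU1P[->|ij]; [by left | right].
  split; first by apply: wk; rewrite leqnn.
  by exists j; split=> // k /andP[ik kj]; apply: wk; rewrite ltnW.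
- by exists i; split=> // k /andP[ik /(leq_ltn_trans ik)]; rewrite ltnn.
- exists j; split=> // [|k /andP[]]; first exact: ltnW.
  by rewrite leq_eqVlt => /predU1P[<-//|ik kj]; apply: wk; rewrite ik.
Qed.

(* Fairness excludes the runs that postpone the second component forever. *)
Definition tr_until : transducer (bool * bool) bool :=
  Transducer (tr_state := bool) (tr_fairness := unit)
    (fun b l b' => b == l.2 || l.1 && b') (fun b _ => b)
    (fun _ b l => ~~ b || l.2).

Section UntilRun.
Variables (w : nat -> bool * bool) (b : nat -> bool).
Hypothesis bS : forall i, b i = (w i).2 || (w i).1 && b i.+1.

Lemma until_run_complete i : word_until w i -> b i.
Proof.
move=> [j [ij wj wk]]; rewrite -(subnKC ij) in wj wk *.
move: (j - i) wj wk {ij} => m; elim: m i => [|m IHm] i wj wk; rewrite bS.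
  by rewrite addn0 in wj; rewrite wj.
rewrite addnS -addSn in wj wk; rewrite wk ?leqnn ?leq_addr //=.
by rewrite IHm ?orbT // => k /andP[ik kj]; rewrite wk // ltnW.
Qed.

Lemma until_run_sound i :
  infinitely_often (fun j => ~~ b j || (w j).2) -> b i -> word_until w i.
Proof.
move=> /(_ i)[j ij wj]; rewrite -(subnKC ij) in wj.
move: (j - i) wj {ij} => m; elim: m i => [|m IHm] i wj bi; apply/word_until_rec.
  by move: wj; rewrite addn0 bi => wi; left.
move: bi; rewrite bS => /orP[|/andP[wi bi]]; [by left | right; split=> //].
by apply: IHm; rewrite // addSnnS.
Qed.

End UntilRun.

Lemma computes_until : computes tr_until (fun w i => `[< word_until w i >]).
Proof.
move=> w v; split=> [[b [bS b_fair] bv]|->].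
  have {}bS i : b i = (w i).2 || (w i).1 && b i.+1 by exact/eqP/bS.
  apply/funext => i; rewrite -bv; apply/esym/asbool_equiv_eqP; first exact: idP.
  by split; [exact: until_run_complete | exact/until_run_sound/(b_fair tt)].
exists (fun i => `[< word_until w i >]) => //; split=> [i|_ N] /=.
  rewrite -[(w i).2]asboolb -[(w i).1]asboolb -asbool_and -asbool_or.
  exact/eqP/asbool_equiv_eq/word_until_rec.
have [[j [Nj wj _]]|nU] := pselect (word_until w N).
  by exists j; rewrite // wj orbT.
by exists N; rewrite // asboolF.
Qed.

(** * Büchi automata *)

Record buchi (L : Type) := Buchi {
  b_state : finType;
  b_init : b_state;
  b_trans : b_state -> L -> b_state -> bool;
  b_acc : b_state -> bool
}.

Definition buchi_accepts (L : Type) (B : buchi L) (w : nat -> L) : Prop :=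
  exists q : nat -> b_state B,
    [/\ q 0 = b_init B, forall i, b_trans (q i) (w i) (q i.+1) &
        infinitely_often (fun i => b_acc (q i))].

Section Collect.
Variable I : finType.

Definition collect (S U : {set I}) : {set I} :=
  (if S == setT then set0 else S) :|: U.

Variables (U S : nat -> {set I}).
Hypothesis SS : forall k, S k.+1 = collect (S k) (U k).

Lemma collect_full_hit i :
  infinitely_often (fun k => S k == setT) ->
  infinitely_often (fun k => i \in U k).
Proof.
move=> full N; have [k Nk Sk] := full N; have [m km Sm] := full k.+1.
apply: contrapT => nU.
have nUi j : N <= j -> i \notin U j.
  by move=> Nj; apply/negP => Uj; apply: nU; exists j.
suff : i \notin S m by rewrite (eqP Sm) inE.
rewrite -(subnKC km); elim: (m - k.+1) => [|j IHj].
  by rewrite addn0 SS /collect Sk set0U nUi.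
rewrite addnS SS /collect inE negb_or nUi ?andbT; last first.
  by rewrite (leq_trans Nk) // (leq_trans (leqnSn k)) // leq_addr.
by case: ifP => // _; rewrite inE.
Qed.

Lemma collect_hit_full :
  (forall i, infinitely_often (fun k => i \in U k)) ->
  infinitely_often (fun k => S k == setT).
Proof.
move=> hit; apply: contrapT.
move=> /not_infinitely_often[N /(_ _ _)/negP/negPf nfull].
have grow i k m : N <= k -> k <= m -> i \in S k -> i \in S m.
  move=> Nk /subnKC <- Sk; elim: (m - k) => [|j IHj]; first by rewrite addn0.
  by rewrite addnS SS /collect nfull ?inE ?IHj // (leq_trans Nk) ?leq_addr.
have /choice[h hP] : forall i, exists k, N <= k /\ i \in S k.
  move=> i; have [k Nk Uk] := hit i N; exists k.+1; split; first exact: leqW.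
  by rewrite SS inE Uk orbT.
pose m := maxn N (\max_i h i).
suff full : S m == setT by rewrite nfull ?leq_maxl in full.
apply/eqP/setP => i; rewrite inE; have [Nh Sh] := hP i.
by apply: grow Sh; rewrite // leq_max leq_bigmax orbT.
Qed.

End Collect.

Section Degeneralization.
Variables (L : Type) (X : transducer L bool).

Definition degeneralized_state : finType :=
  (tr_state X * {set tr_fairness X})%type.

Definition fair_set (x : tr_state X) (l : L) : {set tr_fairness X} :=
  [set f | tr_fair f x l].

Definition degeneralized_step (q : degeneralized_state) (l : L)
    (q' : degeneralized_state) : bool :=
  tr_step q.1 l q'.1 && (q'.2 == collect q.2 (fair_set q.1 l)).

(* The set in a state collects the fairness conditions met since it was last
   full. *)
Definition degeneralized : buchi L :=
  Buchi (b_state := option degeneralized_state) None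
    (fun q l q' =>
       match q, q' with
       | Some x, Some x' => degeneralized_step x l x'
       | None, Some x' =>
           [exists x, tr_out x l && degeneralized_step (x, set0) l x']
       | _, None => false
       end)
    (fun q => if q is Some x then x.2 == setT else false).

Lemma degeneralized_accepts_transduces w :
  buchi_accepts degeneralized w -> exists2 v, transduces X w v & v 0.
Proof.
move=> [q [q_0 qS q_full]].
have /choice[y yP] : forall i, exists y, q i.+1 = Some y.
  by move=> i; have := qS i; case: (q i.+1) => [y|]; [exists y | case: (q i)].
have := qS 0; rewrite q_0 yP => /existsP[x0 /andP[out0 step0]].
pose z i := if i is j.+1 then y j else (x0, set0).
have zS i : degeneralized_step (z i) (w i) (z i.+1).
  by case: i => [|i] //=; have := qS i.+1; rewrite !yP.
exists (fun i => tr_out (z i).1 (w i)) => //.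
exists (fun i => (z i).1) => //; split=> [i|f]; first by have /andP[] := zS i.
have z_full : infinitely_often (fun i => (z i).2 == setT).
  move=> N; have [[|i]// Ni] := q_full N.+1.
  by rewrite yP; exists i.+1; first exact: ltnW.
have collected i : (z i.+1).2 = collect (z i).2 (fair_set (z i).1 (w i)).
  by have /andP[_ /eqP] := zS i.
have fair_hit := collect_full_hit collected f z_full.
by move=> N; have [i Ni] := fair_hit N; rewrite inE; exists i.
Qed.

Lemma transduces_degeneralized_accepts w v :
  transduces X w v -> v 0 -> buchi_accepts degeneralized w.
Proof.
move=> [x [xS x_fair] xv] v0.
pose U i := fair_set (x i) (w i).
pose S := fix S i := if i is j.+1 then collect (S j) (U j) else set0.
exists (fun i => if i is 0 then None else Some (x i, S i)); split=> //.
  case=> [|i] /=; last by rewrite /degeneralized_step xS eqxx.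
  by apply/existsP; exists (x 0); rewrite xv v0 /degeneralized_step xS eqxx.
have S_full : infinitely_often (fun i => S i == setT).
  apply: (@collect_hit_full _ U) => // f N; have [i Ni fi] := x_fair f N.
  by exists i; rewrite ?inE.
by move=> N; have [[|i]// Ni Si] := S_full N.+1; exists i.+1; first exact: ltnW.
Qed.

Lemma degeneralizedP w :
  buchi_accepts degeneralized w <-> exists2 v, transduces X w v & v 0.
Proof.
split=> [|[v]]; first exact: degeneralized_accepts_transduces.
exact: transduces_degeneralized_accepts.
Qed.

End Degeneralization.

(** * Satisfaction levels of prioritized specifications *)

Section Level.
Variable V : finType.

Fixpoint ltl_transducer (f : ltl V) : transducer {set V} bool :=
  match f with
  | LTrue => letterwise (fun=> true)
  | LVar v => letterwise (fun a : {set V} => v \in a)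
  | LNot g => tr_comp (ltl_transducer g) (letterwise negb)
  | LOr g h => tr_comp (tr_pair (ltl_transducer g) (ltl_transducer h))
                 (letterwise (fun b => b.1 || b.2))
  | LNext g => tr_comp (ltl_transducer g) (tr_shift _)
  | LUntil g h =>
      tr_comp (tr_pair (ltl_transducer g) (ltl_transducer h)) tr_until
  end.

Lemma computes_ltl (f : ltl V) :
  computes (ltl_transducer f) (fun sigma i => `[< ltl_sat_at sigma f i >]).
Proof.
elim: f => [|v|g IHg|g IHg h IHh|g IHg|g IHg h IHh] /=.
- apply: eq_computes (computes_letterwise _) => sigma i.
  exact/esym/asboolT.
- apply: eq_computes (computes_letterwise _) => sigma i.
  exact/esym/asboolb.
- apply: eq_computes (computes_comp IHg (computes_letterwise _)) => sigma i.
  by rewrite asbool_neg.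
- apply: eq_computes (computes_comp (computes_pair IHg IHh)
    (computes_letterwise _)) => sigma i.
  by rewrite asbool_or.
- exact: computes_comp IHg (@computes_shift _).
apply: eq_computes (computes_comp (computes_pair IHg IHh) computes_until).
move=> sigma i; apply: asbool_equiv_eq; split=> -[j [ij /asboolP hj gk]].
  by exists j; split=> // k /gk/asboolP.
by exists j; split=> // k /gk gk'; apply/asboolP.
Qed.

Definition level (fs : seq (ltl V)) (sigma : computation V) (i : nat) : nat :=
  find (fun f => ~~ `[< ltl_sat_at sigma f i >]) fs.

Lemma sat_upto_level n (phi : n.-tuple (ltl V)) sigma k : k <= n ->
  sat_upto phi sigma k <-> k <= level phi sigma 0.
Proof.
move=> kn; rewrite leqNgt -has_take_leq ?size_tuple // -all_predC.
have nthE (i : 'I_n) : i < k -> nth (LTrue V) (take k phi) i = tnth phi i.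
  by move=> ik; rewrite nth_take // (tnth_nth (LTrue V)).
split=> [sat|/(all_nthP (LTrue V)) sat i ik].
  apply/(all_nthP (LTrue V)) => i; rewrite size_takel ?size_tuple // => ik.
  rewrite (nthE (Ordinal (leq_trans ik kn)) ik) /= negbK.
  exact/asboolP/sat.
have := sat i; rewrite size_takel ?size_tuple // => /(_ ik).
by rewrite /= negbK nthE // => /asboolP.
Qed.

Fixpoint level_transducer (fs : seq (ltl V)) : transducer {set V} nat :=
  if fs is f :: fs' then
    tr_comp (tr_pair (ltl_transducer f) (level_transducer fs'))
      (letterwise (fun bk => if bk.1 then bk.2.+1 else 0))
  else letterwise (fun=> 0).

Lemma computes_level (fs : seq (ltl V)) :
  computes (level_transducer fs) (level fs).
Proof.
elim: fs => [|f fs IHfs] /=; first exact: eq_computes (computes_letterwise _).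
apply: eq_computes (computes_comp (computes_pair (computes_ltl f) IHfs)
  (computes_letterwise _)) => sigma i.
by rewrite /level /=; case: asbool.
Qed.

Definition level_along (L : Type) (h : L -> {set V}) (fs : seq (ltl V))
    : transducer L nat :=
  tr_comp (letterwise h) (level_transducer fs).

Lemma computes_level_along (L : Type) (h : L -> {set V}) (fs : seq (ltl V)) :
  computes (level_along h fs) (fun w => level fs (h \o w)).
Proof. exact: computes_comp (computes_letterwise h) (computes_level fs). Qed.

End Level.

(** * Dominance as avoidance of a Büchi language *)

Section Dominance.
Variables (A : architecture) (p : proc A).
Implicit Types (T : pred (anode p)) (s t : annotation p) (pi : apath p).

Definition step_valuation (oe : outval p * envval p) : {set var A} :=
  val oe.1 :|: val oe.2.

Definition annotated_path s pi (i : nat) : outval p * envval p :=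
  (s (path_odd pi i), (pi i).2).

Definition path_avoids (B : buchi (outval p * envval p)) T s : Prop :=
  forall pi, path_in T pi -> ~ buchi_accepts B (annotated_path s pi).

Lemma path_evenS pi i :
  path_even pi i.+1 = path_even pi i ++ [:: inl (pi i).1; inr (pi i).2].
Proof. by rewrite /path_even mkseqS flatten_rcons. Qed.

Lemma size_path_even pi i : size (path_even pi i) = i.*2.
Proof. by elim: i => // i IHi; rewrite path_evenS size_cat IHi addn2. Qed.

Lemma size_path_odd pi i : size (path_odd pi i) = i.*2.+1.
Proof. by rewrite size_rcons size_path_even. Qed.

Variables (n : nat) (phi : n.-tuple (ltl (var A))).

Lemma dominatedP T t s :
  dominated phi T t s <->
  forall pi, path_in T pi ->
    level phi (path_computation t pi) 0 <= level phi (path_computation s pi) 0.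
Proof.
split=> [dom pi piT|le_level pi piT m /andP[_ mn] /(sat_upto_level _ _ mn) mt].
  set m := level _ (path_computation t pi) 0; have [->|m0] := posnP m => //.
  have mn : m <= n by rewrite -[n](size_tuple phi) find_size.
  have m_sat := (sat_upto_level phi _ mn).2 (leqnn m).
  have [|k [/andP[mk kn]]] := dom pi piT m _ m_sat; first by rewrite m0.
  by rewrite sat_upto_level //; exact: leq_trans.
exists m; rewrite leqnn mn sat_upto_level //; split=> //.
exact: leq_trans mt (le_level pi piT).
Qed.

Definition rival_transducer : transducer (outval p * envval p) bool :=
  tr_comp (tr_guess _ (outval p))
    (tr_comp (tr_pair (level_along (fun l => step_valuation l.2) phi)
                (level_along (fun l => step_valuation (l.1, l.2.2)) phi))
       (letterwise (fun k => k.1 < k.2))).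

Definition rival_automaton : buchi (outval p * envval p) :=
  degeneralized rival_transducer.

Lemma transduces_rival w v :
  transduces rival_transducer w v <->
  exists o : nat -> outval p, v = (fun i =>
    level phi (step_valuation \o w) i <
    level phi (fun j => step_valuation (o j, (w j).2)) i).
Proof.
have compare := computes_comp
  (computes_pair
    (computes_level_along (fun l : _ * (_ * _) => step_valuation l.2) phi)
    (computes_level_along (fun l => step_valuation (l.1, l.2.2)) phi))
  (computes_letterwise (fun k => k.1 < k.2)).
rewrite transduces_comp; split=> [[_ /transduces_guess[o ->]]|[o ->]].
  by move=> /compare ->; exists o.
exists (fun i => (o i, w i)); last exact/compare.
by apply/transduces_guess; exists o.
Qed.

Lemma rival_automatonP (w : nat -> outval p * envval p) :
  buchi_accepts rival_automaton w <->
  exists o : nat -> outval p,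
    level phi (step_valuation \o w) 0 <
    level phi (fun i => step_valuation (o i, (w i).2)) 0.
Proof.
rewrite degeneralizedP; split=> [[v /transduces_rival[o ->]]|[o lt_level]].
  by exists o.
by eexists; first by apply/transduces_rival; exists o.
Qed.

Lemma dominant_avoids T s :
  dominant phi T s <-> path_avoids rival_automaton T s.
Proof.
split=> [dom pi piT /rival_automatonP[o]|avoid t].
  pose t (v : anode p) := o (size v)./2.
  rewrite ltnNge => /negP; apply.
  have -> : (fun i => step_valuation (o i, (annotated_path s pi i).2)) =
            path_computation t pi.
    apply/funext => i; rewrite /path_computation /t size_path_odd.
    by rewrite /= uphalf_double.
  exact: (dominatedP T t s).1 (dom t) pi piT.
apply/dominatedP => pi piT; rewrite leqNgt; apply/negP => lt_level.
apply: (avoid pi piT); apply/rival_automatonP.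
by exists (fun i => t (path_odd pi i)).
Qed.

End Dominance.

(** * Encodings of assumption trees *)

(* The phases of a branch of an encoded tree: a number is expected (PNum), the
   unary code of a number is being read (PUnary), a valuation is expected
   (PEnv), no present node is below (PDead). *)
Inductive phase := PNum | PUnary | PEnv | PDead.

Definition phase_bits (x : phase) : bool * bool :=
  match x with
  | PNum => (false, false)
  | PUnary => (false, true)
  | PEnv => (true, false)
  | PDead => (true, true)
  end.

Definition phase_of_bits (c : bool * bool) : phase :=
  match c with
  | (false, false) => PNum
  | (false, true) => PUnary
  | (true, false) => PEnv
  | (true, true) => PDead
  end.

Lemma phase_bitsK : cancel phase_bits phase_of_bits.
Proof. by case. Qed.

HB.instance Definition _ := Finite.copy phase (can_type phase_bitsK).

Section Encoding.
Variables (A : architecture) (p : proc A).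
Implicit Types (v : anode p) (w : seq (bdir p)) (t : seq (bdir p) -> label p).

Lemma code_cat v v' : code (v ++ v') = code v ++ code v'.
Proof. by rewrite /code map_cat flatten_cat. Qed.

Lemma code_rcons v d : code (rcons v d) = code v ++ code_dir d.
Proof. by rewrite /code map_rcons flatten_rcons. Qed.

Lemma code_dir_inj (d d' : adir p) w w' :
  code_dir d ++ w = code_dir d' ++ w' -> d = d' /\ w = w'.
Proof.
case: d d' => [a|e] [b|e'] /=; [|by case: a|by case: b|by case=> -> ->].
by elim: a b => [|a IHa] [|b] //= [] // /IHa[[->] ->].
Qed.

Lemma code_prefix v v' w :
  code v ++ w = code v' -> exists2 v'', v' = v ++ v'' & w = code v''.
Proof.
elim: v v' => [|d v IHv] [|d' v'] /=; [by exists [::]|by exists (d' :: v')| |].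
  by case: d => [[|a]|e].
rewrite /code /= -catA => /code_dir_inj[<- /IHv[v'' -> ->]].
by exists v''.
Qed.

Lemma code_inj : injective (@code A p).
Proof.
move=> v v' e; have := @code_prefix v v' [::]; rewrite cats0.
case=> // -[|d v''] ->; first by rewrite cats0.
by case: d => [[|a]|].
Qed.

Lemma code_neq_unary v v' a : code v <> code v' ++ nseq a.+1 (inl false).
Proof.
rewrite -addn1 nseqD catA => /(congr1 (last (inl true))); rewrite last_cat /=.
by case/lastP: v => // v [b|e]; rewrite code_rcons last_cat //= last_rcons.
Qed.

Lemma alternating_cat b v v' :
  alternating b (v ++ v') =
  alternating b v && alternating (b (+) odd (size v)) v'.
Proof.
elim: v b => [|d v IHv] b /=; first by rewrite addbF.
by case: d b => _ []; rewrite //= IHv; case: odd.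
Qed.

Lemma alternating_rcons v d :
  alternating true (rcons v d) =
  alternating true v && (if d is inl _ then ~~ odd (size v) else odd (size v)).
Proof. by rewrite -cats1 alternating_cat; case: d; case: odd. Qed.

Lemma number_node_odd v : alternating true v -> number_node v = odd (size v).
Proof.
have number_node_rcons u d :
    number_node (rcons u d) = if d is inl _ then true else false :> bool.
  by case: u => // c u; rewrite /number_node /= last_rcons.
case/lastP: v => // v d; rewrite alternating_rcons size_rcons.
by rewrite number_node_rcons /=; case: d => _ /andP[_]; case: odd.
Qed.

Definition phase_step (x : phase) (present : bool) (d : bdir p) : phase :=
  match x, d with
  | PNum, inl b => if present then (if b then PEnv else PUnary) else PDead
  | PUnary, inl b => if b then PEnv else PUnary
  | PEnv, inr _ => if present then PNum else PDead
  | _, _ => PDead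
  end.

Definition phase_ok (x : phase) (l : label p) : bool :=
  match x with
  | PNum => l.2 == None
  | PEnv => l.1 == isSome l.2
  | _ => l == (false, None)
  end.

Fixpoint phase_at_rev t w : phase :=
  if w is d :: w' then phase_step (phase_at_rev t w') (t (rev w')).1 d
  else PNum.

Definition phase_at t w : phase := phase_at_rev t (rev w).

Lemma phase_at_rcons t w d :
  phase_at t (rcons w d) = phase_step (phase_at t w) (t w).1 d.
Proof. by rewrite /phase_at rev_rcons /= revK. Qed.

Lemma phase_at_dead t w w' :
  phase_at t w = PDead -> phase_at t (w ++ w') = PDead.
Proof.
move=> dead; elim/last_ind: w' => [|w' d IHw']; first by rewrite cats0.
by rewrite -rcons_cat phase_at_rcons IHw'.
Qed.

Definition node_phase v : phase := if odd (size v) then PEnv else PNum.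

Lemma node_phase_rcons v d : alternating true (rcons v d) ->
  node_phase (rcons v d) = if d is inl _ then PEnv else PNum.
Proof.
rewrite alternating_rcons /node_phase size_rcons /=.
by case: d => _ /andP[_]; case: odd.
Qed.

Variant phase_spec w : phase -> Prop :=
| PhaseNode v of w = code v & alternating true v : phase_spec w (node_phase v)
| PhaseUnary v a of w = code v ++ nseq a.+1 (inl false) & alternating true v
    & ~~ odd (size v) : phase_spec w PUnary
| PhaseDead : phase_spec w PDead.

Lemma phase_atP t w : phase_spec w (phase_at t w).
Proof.
have node v d : alternating true (rcons v d) ->
    phase_spec (code v ++ code_dir d) (if d is inl _ then PEnv else PNum).
  move=> alt; rewrite -(node_phase_rcons alt).
  by apply: PhaseNode; rewrite ?code_rcons.
have number v a : alternating true v -> ~~ odd (size v) ->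
    phase_spec (code v ++ rcons (nseq a (inl false)) (inl true)) PEnv.
  by move=> alt ev; apply: (node v (inl a)); rewrite alternating_rcons alt.
have unary v a : alternating true v -> ~~ odd (size v) ->
    phase_spec (code v ++ rcons (nseq a (inl false)) (inl false)) PUnary.
  by move=> alt ev; apply: (@PhaseUnary _ v a); rewrite // -addn1 nseqD cats1.
elim/last_ind: w => [|w d IHw]; first exact: (@PhaseNode _ [::]).
rewrite phase_at_rcons; case: IHw => [v -> alt|v a -> alt ev|].
- rewrite -cats1 /node_phase; case ov: (odd (size v)); case: d => [b|e] /=;
    try exact: PhaseDead; case: (t _).1; try exact: PhaseDead.
    by apply: (node v (inr e)); rewrite alternating_rcons alt ov.
  by case: b; [apply: (number v 0) | apply: (unary v 0)]; rewrite ?ov.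
- rewrite rcons_cat; case: d => [[]|e] /=; last exact: PhaseDead.
    exact: (number v a.+1).
  exact: (unary v a.+1).
- exact: PhaseDead.
Qed.

Lemma phase_at_code t v :
  phase_at t (code v) = PDead \/
  alternating true v /\ phase_at t (code v) = node_phase v.
Proof.
by case: phase_atP => [v' /code_inj <-|v' a /code_neq_unary|]; [right | | left].
Qed.

Lemma phase_at_absent t u d v :
  (t (code u)).1 = false -> phase_at t (code (u ++ d :: v)) = PDead.
Proof.
move=> u_absent.
have [x [w ->]] : exists x w, code (u ++ d :: v) = rcons (code u) x ++ w.
  rewrite code_cat /code /= -/(code _).
  by case: d => [[|a]|e]; do 2 eexists; rewrite cat_rcons.
apply: phase_at_dead; rewrite phase_at_rcons u_absent.
have [->//|[_ ->]] := phase_at_code t u.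
by rewrite /node_phase; case: odd; case: x.
Qed.

Section Decoding.
Variable t : seq (bdir p) -> label p.
Hypothesis t_ok : forall w, phase_ok (phase_at t w) (t w).

Definition decoded_tree v : bool := (t (code v)).1.

Definition decoded_annotation : annotation p :=
  fun v => odflt (exist _ set0 (sub0set (out p)) : outval p) (t (code v)).2.

Lemma decoded_tree_phase v :
  decoded_tree v -> alternating true v /\ phase_at t (code v) = node_phase v.
Proof.
rewrite /decoded_tree; have := t_ok (code v).
by have [-> /eqP -> | ] := phase_at_code t v.
Qed.

Lemma decoded_tree_assumption : assumption_tree decoded_tree.
Proof.
split=> [u [|d v] uvT|v /decoded_tree_phase[]//]; first by rewrite cats0 in uvT.
have [_] := decoded_tree_phase uvT; apply: contra_eqT => /negPf u_absent.
by rewrite phase_at_absent // /node_phase; case: odd.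
Qed.

Lemma decoded_encodes : encodes decoded_tree decoded_annotation t.
Proof.
split=> [v|w not_code]; last first.
  have := t_ok w.
  by case: phase_atP => [v /not_code//|v a _ _ _ /eqP|/eqP].
have := t_ok (code v); rewrite /decoded_annotation.
case vT: (decoded_tree v); move: (vT); rewrite /decoded_tree; last first.
  by case: (phase_at t _); case: (t _) => [[] [o|]].
have [alt ->] := decoded_tree_phase vT; rewrite number_node_odd // /node_phase.
by case: odd; case: (t _) => [[] [o|]].
Qed.

End Decoding.

Section Encoded.
Variables (T : pred (anode p)) (s : annotation p) (t : seq (bdir p) -> label p).
Hypotheses (treeT : assumption_tree T) (encT : encodes T s t).

Lemma label_code v :
  T v -> t (code v) = (true, if odd (size v) then Some (s v) else None).
Proof.
move=> vT; rewrite encT.1 vT number_node_odd //.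
exact: treeT.2.
Qed.

Lemma phase_at_unary v a : T v -> phase_at t (code v) = PNum ->
  phase_at t (code v ++ nseq a (inl false)) = if a is 0 then PNum else PUnary.
Proof.
move=> vT vN; elim: a => [|a IHa]; first by rewrite cats0.
rewrite -addn1 nseqD catA cats1 phase_at_rcons IHa.
by case: a {IHa} => [|a] //=; rewrite cats0 label_code.
Qed.

Lemma phase_at_present v : T v -> phase_at t (code v) = node_phase v.
Proof.
elim/last_ind: v => [//|v d IHv] vdT; have alt := treeT.2 _ vdT.
have vT : T v by apply: (treeT.1 v [:: d]); rewrite cats1.
have {IHv} ph := IHv vT; rewrite node_phase_rcons // code_rcons.
move: alt; rewrite alternating_rcons => /andP[_].
case: d {vdT} => [a|e] /= parity; last first.
  by rewrite cats1 phase_at_rcons ph /node_phase parity label_code.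
rewrite -rcons_cat phase_at_rcons phase_at_unary //; last first.
  by rewrite ph /node_phase (negPf parity).
by case: a => [|a] //=; rewrite cats0 label_code.
Qed.

Lemma encoded_ok w : phase_ok (phase_at t w) (t w).
Proof.
have [[v [-> vT]]|not_node] := pselect (exists v, w = code v /\ T v).
  by rewrite phase_at_present // label_code // /node_phase; case: odd.
have -> : t w = (false, None); last by case: phase_at.
have [[v wE]|] := pselect (exists v, w = code v); last first.
  by move=> not_code; apply: encT.2 => v wE; apply: not_code; exists v.
rewrite wE encT.1; case vT: (T v) => //.
by case: not_node; exists v.
Qed.

End Encoded.

End Encoding.

(** * Infinite words and concatenations *)

Lemma take_mkseq (D : Type) (w : nat -> D) k m :
  k <= m -> take k (mkseq w m) = mkseq w k.
Proof. by move=> km; rewrite -map_take take_iota (minn_idPl km). Qed.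

Section Concatenation.
Variables (D : Type) (d0 : D) (u : nat -> seq D).
Hypothesis u_gt0 : forall i, 0 < size (u i).

(* Position k is letter j of block i, where (i, j) = block_pos k. *)
Fixpoint block_pos (k : nat) : nat * nat :=
  if k is k'.+1 then
    let: (i, j) := block_pos k' in
    if j.+1 < size (u i) then (i, j.+1) else (i.+1, 0)
  else (0, 0).

Lemma block_posS k i j : block_pos k = (i, j) ->
  block_pos k.+1 = if j.+1 < size (u i) then (i, j.+1) else (i.+1, 0).
Proof. by move=> /= ->. Qed.

Definition block_start (i : nat) : nat := size (flatten (mkseq u i)).

Definition block_concat (k : nat) : D :=
  let: (i, j) := block_pos k in nth d0 (u i) j.

Lemma flatten_mkseqS i : flatten (mkseq u i.+1) = flatten (mkseq u i) ++ u i.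
Proof. by rewrite mkseqS flatten_rcons. Qed.

Lemma block_startS i : block_start i.+1 = block_start i + size (u i).
Proof. by rewrite /block_start flatten_mkseqS size_cat. Qed.

Lemma block_posP k i j : block_pos k = (i, j) ->
  j < size (u i) /\ k = block_start i + j.
Proof.
elim: k i j => [|k IHk] i j /=; first by case=> <- <-; rewrite u_gt0.
case E: (block_pos k) => [i' j']; have [j'u ->] := IHk _ _ E.
case: ltnP => [j'u1 [<- <-]|uj' [<- <-]]; first by rewrite addnS.
rewrite addn0 u_gt0 block_startS -addnS; split=> //; congr (_ + _).
by apply/eqP; rewrite eqn_leq j'u.
Qed.

Lemma block_pos_start i j :
  j < size (u i) -> block_pos (block_start i + j) = (i, j).
Proof.
elim: i j => [|i IHi]; elim=> [|j IHj] ju //.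
- by rewrite add0n /= -[j]add0n IHj ?ju // ltnW.
- rewrite addn0 block_startS -(prednK (u_gt0 i)) addnS /= IHi ?prednK //.
  by rewrite ltnn.
- by rewrite addnS /= IHj ?ju // ltnW.
Qed.

Lemma leq_block_start i : i <= block_start i.
Proof.
elim: i => // i IHi; rewrite block_startS -[i.+1]addn1.
exact: leq_add.
Qed.

Lemma block_start_mono : {homo block_start : i j / i <= j}.
Proof.
by apply: homo_leq leq_trans _ => // i; rewrite block_startS leq_addr.
Qed.

Lemma leq_block_pos i k : block_start i <= k -> i <= (block_pos k).1.
Proof.
case E: (block_pos k) => [i' j'] ik; have [j'u kE] := block_posP E.
rewrite leqNgt; apply/negP => /block_start_mono.
by rewrite block_startS leqNgt (leq_ltn_trans ik) // kE ltn_add2l.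
Qed.

Lemma eq_within_block (X : Type) (b : nat -> X) :
  (forall k i j, block_pos k = (i, j) -> j.+1 < size (u i) -> b k.+1 = b k) ->
  forall k, b k = b (block_start (block_pos k).1).
Proof.
move=> bS; elim=> // k IHk; case E: (block_pos k) => [i j].
case: (ltnP j.+1 (size (u i))) (block_posS E) => [ju|_] kSE.
  by rewrite (bS _ _ _ E ju) IHk kSE E.
by have [_ kS] := block_posP kSE; rewrite kSE {1}kS addn0.
Qed.

Lemma mkseq_block_concat k i j : block_pos k = (i, j) ->
  mkseq block_concat k = flatten (mkseq u i) ++ take j (u i).
Proof.
elim: k i j => [|k IHk] i j /=; first by case=> <- <-; rewrite take0.
rewrite mkseqS {2}/block_concat; case E: (block_pos k) => [i' j'].
have [j'u _] := block_posP E; rewrite (IHk _ _ E) rcons_cat -take_nth //.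
case: ltnP => [_|uj'] [<- <-] //.
by rewrite take0 cats0 flatten_mkseqS take_oversize.
Qed.

Lemma block_concat_unique (w : nat -> D) :
  (forall i, mkseq w (block_start i) = flatten (mkseq u i)) -> w = block_concat.
Proof.
move=> wE; apply/funext => k; case E: (block_pos k) => [i j].
have [ju kE] := block_posP E.
have ki : k < block_start i.+1 by rewrite kE block_startS ltn_add2l.
rewrite -[LHS](nth_mkseq d0 w ki) -[RHS](nth_mkseq d0 block_concat ki) wE.
have /mkseq_block_concat -> : block_pos (block_start i.+1) = (i.+1, 0).
  by rewrite -[block_start _]addn0 block_pos_start.
by rewrite take0 cats0.
Qed.

End Concatenation.

(** * Branches of an encoded tree *)

Section PathWord.
Variables (A : architecture) (p : proc A).
Implicit Types pi : apath p.

Definition path_block pi (i : nat) : seq (bdir p) :=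
  code [:: inl (pi i).1; inr (pi i).2].

Definition path_word pi : nat -> bdir p :=
  block_concat (inl true) (path_block pi).

Lemma path_blockE pi i :
  path_block pi i = nseq (pi i).1 (inl false) ++ [:: inl true; inr (pi i).2].
Proof. by rewrite /path_block /code /= cat_rcons. Qed.

Lemma size_path_block pi i : size (path_block pi i) = (pi i).1.+2.
Proof. by rewrite path_blockE size_cat size_nseq addn2. Qed.

Lemma path_block_gt0 pi i : 0 < size (path_block pi i).
Proof. by rewrite size_path_block. Qed.

Lemma code_path_even pi i :
  code (path_even pi i) = flatten (mkseq (path_block pi) i).
Proof.
by elim: i => // i IHi; rewrite path_evenS code_cat IHi flatten_mkseqS.
Qed.

Section Encoded.
Variables (T : pred (anode p)) (s : annotation p) (t : seq (bdir p) -> label p).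
Hypotheses (treeT : assumption_tree T) (encT : encodes T s t).

Section PathInTree.
Variable pi : apath p.
Hypothesis piT : path_in T pi.

Lemma phase_at_path_even i : phase_at t (code (path_even pi i)) = PNum.
Proof.
rewrite (phase_at_present treeT encT) ?(piT i).1 // /node_phase.
by rewrite size_path_even odd_double.
Qed.

Lemma phase_at_path_word k i j : block_pos (path_block pi) k = (i, j) ->
  j <= (pi i).1 ->
  phase_at t (mkseq (path_word pi) k) = if j is 0 then PNum else PUnary.
Proof.
move=> kE ji; rewrite (mkseq_block_concat _ (path_block_gt0 pi) kE).
rewrite -code_path_even path_blockE takel_cat ?size_nseq // take_nseq //.
by rewrite (phase_at_unary treeT encT) ?(piT i).1 ?phase_at_path_even.
Qed.

Lemma path_word_at_odd k i : block_pos (path_block pi) k = (i, (pi i).1.+1) ->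
  [/\ phase_at t (mkseq (path_word pi) k) = PEnv,
      t (mkseq (path_word pi) k) = (true, Some (s (path_odd pi i))) &
      path_word pi k = inr (pi i).2].
Proof.
move=> kE; have kodd : mkseq (path_word pi) k = code (path_odd pi i).
  rewrite (mkseq_block_concat _ (path_block_gt0 pi) kE) -code_path_even.
  rewrite code_rcons /path_block /code /=.
  by rewrite take_size_cat // size_rcons size_nseq.
have odd_size : odd (size (path_odd pi i)).
  by rewrite size_path_odd /= odd_double.
have [_ oddT] := piT i.
rewrite kodd (phase_at_present treeT encT oddT) (label_code treeT encT oddT).
rewrite /node_phase odd_size; split=> //.
rewrite /path_word /block_concat kE path_blockE nth_cat size_nseq.
by rewrite ltnNge leqnSn subSnn.
Qed.

End PathInTree.

Section PathOfWord.
Variable w : nat -> bdir p.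
Hypothesis w_num : infinitely_often (fun k => phase_at t (mkseq w k) = PNum).

Definition spelled_node (v : anode p) : Prop :=
  [/\ mkseq w (size (code v)) = code v, T v & ~~ odd (size v)].

Lemma spelled_node_late k : exists2 v, k < size (code v) & spelled_node v.
Proof.
have num_node m : phase_at t (mkseq w m) = PNum ->
    exists2 v, mkseq w m = code v & ~~ odd (size v).
  case: phase_atP => // v -> _; rewrite /node_phase.
  by case: ifP => // /negbT ev _; exists v.
have [m km mN] := w_num k.+1; have [v vE ev] := num_node m mN.
have [m' mm' m'N] := w_num m.+1; have [v' v'E _] := num_node m' m'N.
have vm : size (code v) = m by rewrite -vE size_mkseq.
exists v; first by rewrite vm.
split=> //; first by rewrite vm.
have /code_prefix[[|d v''] v'v _] : code v ++ drop m (mkseq w m') = code v'.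
- by rewrite -vE -(take_mkseq w (ltnW mm')) cat_take_drop.
- move: mm'; rewrite -[m'](size_mkseq w) v'E v'v cats0 vm.
  by rewrite ltnn.
apply: contraT => /negPf vT; rewrite v'E v'v phase_at_absent // in m'N.
by rewrite encT.1 vT.
Qed.

Lemma spelled_node_prefix u v : spelled_node (u ++ v) -> ~~ odd (size u) ->
  spelled_node u.
Proof.
move=> [uvE uvT _] eu; split=> //; last exact: treeT.1 uvT.
rewrite -(@take_mkseq _ w _ (size (code (u ++ v)))); last first.
  by rewrite code_cat size_cat leq_addr.
by rewrite uvE code_cat take_size_cat.
Qed.

Lemma spelled_node_extend v : spelled_node v ->
  exists ae : nat * envval p, spelled_node (v ++ [:: inl ae.1; inr ae.2]).
Proof.
move=> [vE vT ev].
have [v' vv' v'_spelled] := spelled_node_late (size (code v)).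
have [v'E v'T ev'] := v'_spelled.
have /code_prefix[v'' v'v _] :
    code v ++ drop (size (code v)) (mkseq w (size (code v'))) = code v'.
  by rewrite -[X in X ++ _]vE -(take_mkseq w (ltnW vv')) cat_take_drop.
have := treeT.2 _ v'T; rewrite v'v alternating_cat (negPf ev) => /andP[_].
rewrite v'v size_cat oddD (negPf ev) /= in ev'.
case: v'' => [|[a|e1] [|[b|e2] v3]] // in v'v ev' *.
  by rewrite v'v cats0 ltnn in vv'.
move=> _; exists (a, e2); apply: (@spelled_node_prefix _ v3).
  by rewrite -catA -v'v.
by rewrite size_cat oddD (negPf ev).
Qed.

Lemma path_of_word : exists2 pi, w = path_word pi & path_in T pi.
Proof.
have root_spelled : spelled_node [::].
  have [v _ v_spelled] := spelled_node_late 0.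
  exact: (@spelled_node_prefix [::] v).
have /choice[child childP] : forall v : {v | spelled_node v},
    exists u : {u | spelled_node u}, exists ae : nat * envval p,
      sval u = sval v ++ [:: inl ae.1; inr ae.2].
  move=> [v v_spelled]; have [ae u_spelled] := spelled_node_extend v_spelled.
  by exists (exist _ _ u_spelled), ae.
pose node i := iter i child (exist _ _ root_spelled).
have /choice[pi piP] := fun i => childP (node i).
have nodeE i : path_even pi i = sval (node i).
  by elim: i => // i IHi; rewrite path_evenS IHi -piP.
have even_spelled i : spelled_node (path_even pi i).
  by rewrite nodeE; exact: svalP.
exists pi => [|i].
  apply: (block_concat_unique _ (path_block_gt0 pi)) => i.
  by rewrite /block_start -code_path_even; have [] := even_spelled i.
split; first by have [] := even_spelled i.
have [_ + _] := even_spelled i.+1; rewrite path_evenS -cat_rcons.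
exact: treeT.1.
Qed.

End PathOfWord.
End Encoded.
End PathWord.

(** * The automaton *)

Section PathAutomaton.
Variables (A : architecture) (p : proc A) (B : buchi (outval p * envval p)).

(* In a state (x, Some b) the automaton follows a run of B along a branch;
   (x, None) only checks the encoding. *)
Definition path_state : finType := (phase * option (b_state B))%type.

Definition path_track (x : phase) (l : label p) (d : bdir p)
    (b b' : option (b_state B)) : bool :=
  match b, b' with
  | Some q, Some q' =>
      if x == PEnv then
        if (l.2, d) is (Some o, inr e) then b_trans q (o, e) q' else false
      else q == q'
  | None, Some _ => false
  | _, None => true
  end.

Definition path_init : path_state := (PNum, Some (b_init B)).

Definition path_ok (q : path_state) (l : label p) : bool := phase_ok q.1 l.

Definition path_next (q : path_state) (l : label p) (d : bdir p)
    (q' : path_state) : bool :=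
  (q'.1 == phase_step q.1 l.1 d) && path_track q.1 l d q.2 q'.2.

(* Infinite unary codes must not be rejected, hence the restriction to PNum. *)
Definition path_bad (q : path_state) : bool :=
  (q.1 == PNum) && (if q.2 is Some b then b_acc b else false).

Definition path_automaton : parity_automaton (bdir p) (label p) :=
  universal_automaton path_init path_ok path_next (fun q => path_bad q : nat).

Section Input.
Variable t : seq (bdir p) -> label p.

Lemma reachable_phase w q :
  reachable path_init path_next t w q -> q.1 = phase_at t w.
Proof.
by elim=> [//|{}w {}q d q' _ qE /andP[/eqP -> _]]; rewrite phase_at_rcons qE.
Qed.

Lemma reachable_every_word w :
  exists b, reachable path_init path_next t w (phase_at t w, b).
Proof.
elim/last_ind: w => [|w d [b w_reach]].
  by exists (Some (b_init B)); exact: reachable_init.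
exists None; apply: reachable_rcons w_reach _.
by rewrite /path_next phase_at_rcons eqxx; case: b.
Qed.

Lemma reachable_path_ok :
  (forall w q, reachable path_init path_next t w q -> path_ok q (t w)) <->
  (forall w, phase_ok (phase_at t w) (t w)).
Proof.
split=> [ok w|ok w q /reachable_phase qE]; last by rewrite /path_ok qE.
by have [b /ok] := reachable_every_word w.
Qed.

Lemma trace_phase w q k :
  infinite_trace path_init path_next t w q -> (q k).1 = phase_at t (mkseq w k).
Proof.
move=> [q_0 qS]; elim: k => [|k IHk]; first by rewrite q_0.
by have /andP[/eqP -> _] := qS k; rewrite IHk mkseqS phase_at_rcons.
Qed.

Lemma trace_tracked w q :
  infinite_trace path_init path_next t w q ->
  infinitely_often (fun k => path_bad (q k)) ->
  exists b, forall k, (q k).2 = Some (b k).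
Proof.
move=> [_ qS] bad_inf.
suff /choice[b bE] : forall k, exists b, (q k).2 = Some b by exists b.
move=> k; case E: (q k).2 => [b|]; first by exists b.
have lost m : (q (k + m)).2 = None.
  elim: m => [|m IHm]; first by rewrite addn0.
  by have /andP[_] := qS (k + m); rewrite addnS IHm /=; case: (q _.+1).2.
by have [m /subnKC <- /andP[_]] := bad_inf k; rewrite lost.
Qed.

Section Encoded.
Variables (T : pred (anode p)) (s : annotation p).
Hypotheses (treeT : assumption_tree T) (encT : encodes T s t).

Lemma path_track_word pi k i j b b' : path_in T pi ->
  block_pos (path_block pi) k = (i, j) ->
  path_track (phase_at t (mkseq (path_word pi) k)) (t (mkseq (path_word pi) k))
    (path_word pi k) (Some b) (Some b') =
  if j.+1 < size (path_block pi i) then b == b'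
  else b_trans b (annotated_path s pi i) b'.
Proof.
move=> piT kE; have [ju _] := block_posP (path_block_gt0 pi) kE.
rewrite size_path_block ltnS in ju *; case: ltnP => ji.
  by rewrite (phase_at_path_word treeT encT piT kE) //; case: j {kE ju ji}.
have jE : j = (pi i).1.+1 by apply/eqP; rewrite eqn_leq ju.
rewrite jE in kE.
by have [-> -> ->] := path_word_at_odd treeT encT piT kE.
Qed.

Lemma accepted_path_trace pi : path_in T pi ->
  buchi_accepts B (annotated_path s pi) ->
  exists2 q, infinite_trace path_init path_next t (path_word pi) q &
    infinitely_often (fun k => path_bad (q k)).
Proof.
move=> piT [b [b_0 bS b_inf]].
exists (fun k => (phase_at t (mkseq (path_word pi) k),
                  Some (b (block_pos (path_block pi) k).1))).
  split=> [|k]; first by rewrite /= b_0.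
  case kE: (block_pos _ k) => [i j]; rewrite (block_posS kE).
  rewrite /path_next mkseqS phase_at_rcons eqxx andTb.
  rewrite [path_track _ _ _ _ _](path_track_word _ _ piT kE).
  by case: ifP => ->.
move=> N; have [i Ni bi] := b_inf N.
exists (block_start (path_block pi) i + 0).
  by rewrite addn0 (leq_trans Ni) // leq_block_start //; exact: path_block_gt0.
have kE := block_pos_start (path_block_gt0 pi) (path_block_gt0 pi i).
by rewrite /path_bad (phase_at_path_word treeT encT piT kE) // kE.
Qed.

Lemma trace_accepted_path pi q : path_in T pi ->
  infinite_trace path_init path_next t (path_word pi) q ->
  infinitely_often (fun k => path_bad (q k)) ->
  buchi_accepts B (annotated_path s pi).
Proof.
move=> piT q_trace bad_inf; have [b bE] := trace_tracked q_trace bad_inf.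
have qph k := trace_phase k q_trace; have [q_0 qS] := q_trace.
pose start := block_start (path_block pi); have block_gt0 := path_block_gt0 pi.
have b_track k i j (kE : block_pos (path_block pi) k = (i, j)) :
    if j.+1 < size (path_block pi i) then b k.+1 = b k
    else b_trans (b k) (annotated_path s pi i) (b k.+1).
  have /andP[_] := qS k; rewrite !bE qph (path_track_word _ _ piT kE).
  by case: ifP => _ // /eqP.
have b_start k : b k = b (start (block_pos (path_block pi) k).1).
  apply: (eq_within_block block_gt0) => {}k i j kE ju.
  by have := b_track _ _ _ kE; rewrite ju.
exists (b \o start); split=> [|i|N] /=.
- by have := bE 0; rewrite q_0 => -[].
- have last_lt : (size (path_block pi i)).-1 < size (path_block pi i).
    by rewrite prednK.
  have kE := block_pos_start block_gt0 last_lt; have := b_track _ _ _ kE.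
  by rewrite prednK // ltnn b_start kE -addnS prednK // -block_startS.
- have [k Nk /andP[_]] := bad_inf (start N); rewrite bE b_start => bk.
  exists (block_pos (path_block pi) k).1 => //.
  exact: (leq_block_pos block_gt0 Nk).
Qed.

Lemma accepts_path_automaton_encoded :
  accepts path_automaton t <-> path_avoids B T s.
Proof.
rewrite accepts_universal reachable_path_ok; split=> [[_ no_bad] pi piT|avoid].
  move=> /(accepted_path_trace piT)[q /no_bad/parity_condition_bool no_bad_q].
  exact.
split=> [|w q q_trace]; first exact: encoded_ok treeT encT.
apply/parity_condition_bool => bad_inf.
have [|pi wE piT] := @path_of_word _ _ _ _ _ treeT encT w.
  move=> N; have [k Nk /andP[/eqP qN _]] := bad_inf N.
  by exists k; rewrite // -(trace_phase k q_trace).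
rewrite wE in q_trace; apply: (avoid pi piT).
exact: trace_accepted_path q_trace bad_inf.
Qed.

End Encoded.

Lemma accepts_path_automaton :
  accepts path_automaton t <->
  exists T s, [/\ assumption_tree T, path_avoids B T s & encodes T s t].
Proof.
split=> [acc|[T [s [treeT avoid encT]]]]; last first.
  exact/(accepts_path_automaton_encoded treeT encT).
have /accepts_universal[/reachable_path_ok t_ok _] := acc.
have treeT := decoded_tree_assumption t_ok; have encT := decoded_encodes t_ok.
exists (decoded_tree t), (decoded_annotation t); split=> //.
exact/(accepts_path_automaton_encoded treeT encT).
Qed.

End Input.
End PathAutomaton.

Theorem theorem2 (A : architecture) (p : proc A) (n : nat) (n_gt0 : 0 < n)
    (phi : n.-tuple (ltl (var A))) :
  { M : parity_automaton (bdir p) (label p) |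
    forall t : seq (bdir p) -> label p,
      accepts M t <->
      exists (T : pred (anode p)) (s : annotation p),
        [/\ assumption_tree T, dominant phi T s & encodes T s t] }.
Proof.
exists (path_automaton (rival_automaton p phi)) => t.
rewrite accepts_path_automaton.
by split=> -[T [s [treeT sT encT]]]; exists T, s; split=> //;
  exact/dominant_avoids.
Qed.
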